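(* Let $P$ be a finite poset. The set $LC(P)$ of all closure relations on $P$, partially ordered by $H\le K$ if and only if $H(x)\le K(x)$ for all $x\in P$, is a lattice. Moreover, identifying each closure relation $H$ with the partition of $P$ it induces, $LC(P)$ is a join-sublattice of the lattice $\Pi(P)$ of all partitions of the elements of $P$; that is, the join of closure relations in $LC(P)$ is the same as their join in $\Pi(P)$.
   Context: A closure relation on a poset $P$ is a map $H:P\to P$ such that for all $x,y\in P$: (1) $x\le H(x)$; (2) $x\le y$ implies $H(x)\le H(y)$; (3) $H(H(x))=H(x)$. A closure relation $H$ is regarded as a partition of the set $P$ by putting $x,y$ in the same block if and only if $H(x)=H(y)$. ($H$ is recovered from this partition, since $H(x)$ is the greatest element of the block containing $x$.) $\Pi(P)$ denotes the lattice of all partitions of the underlying set of $P$, ordered by refinement (finer partitions are smaller). *)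

(* Defs.v *)
From HB Require Import structures.
From mathcomp Require Import all_boot all_order.

Set Implicit Arguments.
Unset Strict Implicit.
Unset Printing Implicit Defensive.

Import Order.TTheory.
Local Open Scope order_scope.

Fact LC_display : Order.disp_t. Proof. exact: (Order.Disp tt tt). Qed.
Fact Pi_display : Order.disp_t. Proof. exact: (Order.Disp tt tt). Qed.

Section Lattices.
Context (d : Order.disp_t) (T : porderType d).
Implicit Types x y z : T.

Definition is_join x y z : Prop :=
  [/\ x <= z, y <= z & forall u : T, x <= u -> y <= u -> z <= u].

Definition is_meet x y z : Prop :=
  [/\ z <= x, z <= y & forall u : T, u <= x -> u <= y -> u <= z].

End Lattices.

(* "The partially ordered set [T] is a lattice": MathComp's [latticeType] is a
   structure carrying chosen operations, not a property of an order. *)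
Definition is_lattice (d : Order.disp_t) (T : porderType d) : Prop :=
  forall x y : T, (exists z, is_join x y z) /\ (exists z, is_meet x y z).

Section Closures.
Context (d : Order.disp_t) (P : finPOrderType d).

Definition is_closure (f : {ffun P -> P}) : bool :=
  [&& [forall x, x <= f x],
      [forall x, forall y, (x <= y) ==> (f x <= f y)]
    & [forall x, f (f x) == f x]].

Record LC := Closure {
  closure_fun :> {ffun P -> P};
  closure_funP : is_closure closure_fun
}.

HB.instance Definition _ := [isSub for closure_fun].
HB.instance Definition _ := [Finite of LC by <:].

Definition LC_le (H K : LC) : bool := [forall x, H x <= K x].

Fact LC_le_refl : reflexive LC_le.
Proof. by move=> H; apply/forallP=> x. Qed.

Fact LC_le_anti : antisymmetric LC_le.
Proof.
move=> H K /andP[/forallP HK /forallP KH]; apply/val_inj/ffunP=> x.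
by apply/le_anti; rewrite HK KH.
Qed.

Fact LC_le_trans : transitive LC_le.
Proof.
move=> K H L /forallP HK /forallP KL; apply/forallP=> x.
exact: le_trans (HK x) (KL x).
Qed.

HB.instance Definition _ :=
  Order.Le_isPOrder.Build LC_display LC LC_le_refl LC_le_anti LC_le_trans.

End Closures.

Section Partitions.
Context (T : finType).

Record Pi := Partition {
  blocks :> {set {set T}};
  blocksP : partition blocks [set: T]
}.

HB.instance Definition _ := [isSub for blocks].
HB.instance Definition _ := [Finite of Pi by <:].

Definition Pi_le (A B : Pi) : bool :=
  [forall X in blocks A, exists Y in blocks B, X \subset Y].

Fact Pi_le_refl : reflexive Pi_le.
Proof.
by move=> A; apply/forall_inP=> X AX; apply/exists_inP; exists X.
Qed.

Fact Pi_le_trans : transitive Pi_le.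
Proof.
move=> B A C /forall_inP AB /forall_inP BC; apply/forall_inP=> X /AB.
case/exists_inP=> Y /BC /exists_inP[Z CZ YZ] XY.
by apply/exists_inP; exists Z => //; exact: subset_trans XY YZ.
Qed.

Fact Pi_le_anti : antisymmetric Pi_le.
Proof.
have sub (A B : Pi) : Pi_le A B -> Pi_le B A -> blocks A \subset blocks B.
  move=> /forall_inP AB /forall_inP BA; apply/subsetP=> X AX.
  have /exists_inP[Y BY XY] := AB X AX.
  have /exists_inP[Z AZ YZ] := BA Y BY.
  have /and3P[_ tA A0] := blocksP A.
  have [x Xx] : exists x, x \in X.
    by apply/set0Pn; apply: contraNneq A0 => <-.
  have Zx : x \in Z by apply: (subsetP YZ); apply: (subsetP XY).
  have XZ : X = Z by rewrite -(def_pblock tA AX Xx) (def_pblock tA AZ Zx).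
  suff -> : X = Y by [].
  by apply/eqP; rewrite eqEsubset XY {1}XZ.
move=> A B /andP[AB BA]; apply/val_inj/eqP.
by rewrite eqEsubset; apply/andP; split; apply: sub.
Qed.

HB.instance Definition _ :=
  Order.Le_isPOrder.Build Pi_display Pi Pi_le_refl Pi_le_anti Pi_le_trans.

End Partitions.

Definition partition_of_closure (d : Order.disp_t) (P : finPOrderType d)
    (H : LC P) : Pi P :=
  Partition (preim_partitionP H [set: P]).

(* Main.v *)
Require Import Defs.
From mathcomp Require Import all_boot all_order.

(** Composing the members of a finite family of closure relations gives an
    inflationary monotone map F, usually not idempotent.  Since P is finite,
    iterating F from any point reaches a fixed point, and iterating #|P| times
    suffices for all points at once; the result is a closure relation, and it is
    the supremum of the family ([cl_comp_ge], [cl_comp_le]).  So LC P has all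
    finite joins, and since it is itself finite, the meet of H and K is the
    supremum of their common lower bounds.

    The map sending a closure relation to its partition reflects the order as
    well as preserving it ([le_partition_of_closure]): H x always lies in the
    H-block of x, so if H-blocks are inside K-blocks then K (H x) = K x, whence
    H x <= K x.  This makes the map injective.

    For the comparison of joins, the point is that the join J of H and K moves x
    to J x by finitely many steps, each applying H or K.  A partition coarser
    than those of H and K cannot separate the two ends of such a step, so it has
    x and J x in one block ([pblock_cl_comp]); if J x = J y, then x and y share
    a block too.  The partition of J is thus the finest one above the other
    two. *)

Set Implicit Arguments.
Unset Strict Implicit.
Unset Printing Implicit Defensive.

Import Order.TTheory.
Local Open Scope order_scope.

Section ClosureTheory.
Context (d : Order.disp_t) (P : finPOrderType d).
Implicit Types (H K L U : LC P) (x y : P) (s : seq (LC P)) (F : P -> P).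

Lemma closure_ge H x : x <= H x.
Proof. by have /and3P[/forallP] := closure_funP H. Qed.

Lemma closure_mono H : {homo H : x y / x <= y}.
Proof.
have /and3P[_ /forallP mH _] := closure_funP H => x y.
exact/implyP/(forallP (mH x)).
Qed.

Lemma closureK H x : H (H x) = H x.
Proof. by have /and3P[_ _ /forallP/(_ x)/eqP] := closure_funP H. Qed.

Lemma LC_leP H K : reflect (forall x, H x <= K x) (H <= K).
Proof. exact: forallP. Qed.

Lemma closure_absorb H K x : H <= K -> K (H x) = K x.
Proof.
move/LC_leP=> leHK; apply/le_anti/andP; split.
  by rewrite -[leRHS]closureK closure_mono.
exact/closure_mono/closure_ge.
Qed.

(** The orbit of x cannot have #|P| + 1 distinct points, so it repeats a value;
    being nondecreasing, it is stationary from the first repeated value on. *)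
Lemma iter_card_fixed F x :
  (forall y, y <= F y) -> F (iter #|P| F x) = iter #|P| F x.
Proof.
move=> geF; have chain m n : (m <= n)%N -> iter m F x <= iter n F x.
  by move/subnK <-; elim: (n - m)%N => //= k /le_trans; apply.
have : looping F x #|P|.
  apply: contraT; rewrite -looping_uniq => /card_uniqP eq_sz.
  by have := max_card [in traject F x #|P|.+1]; rewrite eq_sz size_traject ltnn.
case/trajectP=> i lt_i_n eq_i; apply/le_anti.
by rewrite geF andbT [in leRHS]eq_i {1}eq_i (le_trans (chain _ _ lt_i_n)) ?eq_i.
Qed.

(** Idempotence is where finiteness of P matters: the exponent #|P| makes every
    value of the iterate a fixed point of F. *)
Lemma is_closure_iter F :
    (forall x, x <= F x) -> {homo F : x y / x <= y} ->
  is_closure [ffun x => iter #|P| F x].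
Proof.
move=> geF monoF; apply/and3P; split.
- apply/forallP=> x; rewrite ffunE.
  by elim: #|P| => //= n /le_trans; apply.
- apply/forallP=> x; apply/forallP=> y; apply/implyP=> le_xy; rewrite !ffunE.
  by elim: #|P| => //= n; apply: monoF.
- by apply/forallP=> x; rewrite !ffunE iter_fix ?iter_card_fixed.
Qed.

Definition closure_comp s : P -> P := foldr (fun H f => H \o f) id s.

Lemma closure_comp_ge s x : x <= closure_comp s x.
Proof. by elim: s => //= H s /le_trans; apply; apply: closure_ge. Qed.

Lemma closure_comp_mono s : {homo closure_comp s : x y / x <= y}.
Proof. by elim: s => //= H s IHs x y /IHs; apply: closure_mono. Qed.

Definition cl_comp s : LC P :=
  Closure (is_closure_iter (closure_comp_ge s) (@closure_comp_mono s)).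

Lemma cl_compE s x : cl_comp s x = iter #|P| (closure_comp s) x.
Proof. exact: ffunE. Qed.

(** The factors being inflationary and monotone, H y <= [closure_comp s y] for
    each factor H.  Hence H fixes [cl_comp s x], which the composition fixes. *)
Lemma cl_comp_ge s H : H \in s -> H <= cl_comp s.
Proof.
move=> sH; apply/LC_leP=> x.
apply: le_trans (closure_mono H (closure_ge (cl_comp s) x)) _.
have fix_x : closure_comp s (cl_comp s x) = cl_comp s x.
  by rewrite cl_compE iter_card_fixed //; apply: closure_comp_ge.
rewrite -[leRHS]fix_x; elim: s sH (cl_comp s x) {fix_x} => //= K s IHs.
rewrite inE => /predU1P[-> | /IHs le_s] y; first exact/closure_mono/closure_comp_ge.
exact: le_trans (le_s y) (closure_ge _ _).
Qed.

(** Maps below U compose to a map below U, because U is monotone and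
    idempotent: F (G x) <= U (G x) <= U (U x) = U x; so the composition of s, and
    then each of its iterates, lies below U. *)
Lemma cl_comp_le s U : (forall H, H \in s -> H <= U) -> cl_comp s <= U.
Proof.
move=> leU; have le_comp x : closure_comp s x <= U x.
  elim: s leU => /= [|H s IHs] leU; first exact: closure_ge.
  have /LC_leP leHU := leU H (mem_head _ _).
  rewrite -[leRHS]closureK.
  rewrite (le_trans (closure_mono H (IHs _)) (leHU _)) // => K sK.
  by rewrite leU // inE sK orbT.
apply/LC_leP=> x; rewrite cl_compE.
elim: #|P| => [|n IHn] /=; first exact: closure_ge.
by rewrite -[leRHS]closureK (le_trans (le_comp _)) // closure_mono.
Qed.

Lemma is_join_cl_comp H K : is_join H K (cl_comp [:: H; K]).
Proof.
split=> [||U leHU leKU]; try by rewrite cl_comp_ge // !inE eqxx ?orbT.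
by apply: cl_comp_le => L; rewrite !inE => /pred2P[] ->.
Qed.

Lemma is_meet_cl_comp H K :
  is_meet H K (cl_comp (enum [pred L : LC P | (L <= H) && (L <= K)])).
Proof.
split=> [||U leUH leUK].
- by apply: cl_comp_le => L; rewrite mem_enum => /andP[].
- by apply: cl_comp_le => L; rewrite mem_enum => /andP[].
- by rewrite cl_comp_ge // mem_enum inE leUH.
Qed.

End ClosureTheory.

Section PartitionOrder.
Context (T : finType).
Implicit Types (A B : Pi T) (x y : T).

Lemma cover_Pi A : cover A = [set: T].
Proof. by have /and3P[/eqP] := blocksP A. Qed.

Lemma trivIset_Pi A : trivIset A.
Proof. by have /and3P[] := blocksP A. Qed.

Lemma pblock_Pi_eq A x y : (pblock A x == pblock A y) = (y \in pblock A x).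
Proof. by rewrite eq_pblock ?trivIset_Pi // cover_Pi. Qed.

(** Refinement becomes inclusion of equivalence relations, a form that can be
    checked on points and composes well with [pblock_closure_eq]. *)
Lemma Pi_leP A B :
  reflect (forall x y, pblock A x = pblock A y -> pblock B x = pblock B y)
          (A <= B).
Proof.
have inA x : pblock A x \in blocks A by rewrite pblock_mem ?cover_Pi.
have inB x : pblock B x \in blocks B by rewrite pblock_mem ?cover_Pi.
apply: (iffP forall_inP) => [leAB x y /eqP | leAB X AX].
  rewrite pblock_Pi_eq => Axy.
  have /exists_inP[Y BY /subsetP sXY] := leAB _ (inA x).
  have Yx : x \in Y by rewrite sXY // mem_pblock cover_Pi.
  rewrite (def_pblock (trivIset_Pi B) BY Yx) (def_pblock _ BY) ?sXY //.
  exact: trivIset_Pi.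
have [x Xx] : exists x, x \in X.
  apply/set0Pn; have /and3P[_ _] := blocksP A.
  by apply: contraNneq => <-.
apply/exists_inP; exists (pblock B x) => //; apply/subsetP=> y Xy.
rewrite -pblock_Pi_eq; apply/eqP/leAB.
by rewrite !(def_pblock _ AX) ?trivIset_Pi.
Qed.

End PartitionOrder.

Section PartitionOfClosure.
Context (d : Order.disp_t) (P : finPOrderType d).
Implicit Types (H K : LC P) (U : Pi P) (s : seq (LC P)) (x y : P).

Lemma pblock_closure_eq H x y :
  pblock (partition_of_closure H) x = pblock (partition_of_closure H) y
  <-> H x = H y.
Proof.
have eqE : (pblock (partition_of_closure H) x
              == pblock (partition_of_closure H) y) = (H x == H y).
  rewrite pblock_Pi_eq pblock_equivalence_partition // => ? ? ? _ _ _.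
  by split=> // /eqP->.
by split=> /eqP; [rewrite eqE | rewrite -eqE] => /eqP.
Qed.

(** Order reflection uses that H x is in the H-block of x, hence in its K-block,
    whose greatest element is K x. *)
Lemma le_partition_of_closure H K :
  (partition_of_closure H <= partition_of_closure K) = (H <= K).
Proof.
apply/Pi_leP/idP => [leHK | leHK x y].
  apply/LC_leP=> x; suff <- : K (H x) = K x by apply: closure_ge.
  by apply/pblock_closure_eq/leHK/pblock_closure_eq/closureK.
move=> /pblock_closure_eq eqH; apply/pblock_closure_eq.
by rewrite -(closure_absorb x leHK) eqH closure_absorb.
Qed.

Lemma partition_of_closure_inj : injective (@partition_of_closure d P).
Proof.
by move=> H K eqHK; apply/le_anti; rewrite -!le_partition_of_closure eqHK lexx.
Qed.

(** Each y and H y lie in a common H-block, hence in a common block of U; so no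
    step on the way from x to its closure leaves the block of x in U. *)
Lemma pblock_cl_comp s U x :
    (forall H, H \in s -> partition_of_closure H <= U) ->
  pblock U (cl_comp s x) = pblock U x.
Proof.
move=> leU; have blockU H y : H \in s -> pblock U (H y) = pblock U y.
  by move=> /leU/Pi_leP; apply; apply/pblock_closure_eq/closureK.
have block_comp y : pblock U (closure_comp s y) = pblock U y.
  elim: s blockU {leU} => //= H s IHs blockU.
  rewrite blockU ?mem_head // IHs // => K z sK.
  by rewrite blockU // inE sK orbT.
by rewrite cl_compE; elim: #|P| => //= n; rewrite block_comp.
Qed.

Lemma is_join_partition_cl_comp H K :
  is_join (partition_of_closure H) (partition_of_closure K)
          (partition_of_closure (cl_comp [:: H; K])).
Proof.
have [leHJ leKJ _] := is_join_cl_comp H K.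
split=> [||U leHU leKU]; rewrite ?le_partition_of_closure //.
have leU L : L \in [:: H; K] -> partition_of_closure L <= U.
  by rewrite !inE => /pred2P[] ->.
apply/Pi_leP=> x y /pblock_closure_eq eqJ.
by rewrite -(pblock_cl_comp x leU) eqJ pblock_cl_comp.
Qed.

End PartitionOfClosure.

Lemma is_join_unique (d : Order.disp_t) (T : porderType d) (x y z t : T) :
  is_join x y z -> is_join x y t -> z = t.
Proof.
move=> [lexz leyz minz] [lext leyt mint].
by apply/le_anti; rewrite minz // mint.
Qed.

Theorem theorem1 (d : Order.disp_t) (P : finPOrderType d) :
  is_lattice (LC P) /\
  injective (@partition_of_closure d P) /\
  (forall H K J : LC P, is_join H K J ->
     is_join (partition_of_closure H) (partition_of_closure K)
             (partition_of_closure J)).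
Proof.
split; last split.
- move=> H K; split; first by eexists; apply: is_join_cl_comp.
  by eexists; apply: is_meet_cl_comp.
- exact: partition_of_closure_inj.
- move=> H K J /is_join_unique/(_ (is_join_cl_comp H K)) ->.
  exact: is_join_partition_cl_comp.
Qed.
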